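(* Let $\delta\ge0$, $\varepsilon>0$, $\tau>0$, let $(\cdot,\cdot)_*$ be an inner product on $V_h$ with induced norm $\|\cdot\|_*$, and let $u_h^0\in\mathcal{A}_h$ with $u_{h,3}^0\ge\delta$ at all nodes. Consider the conical sheet flow iteration: for $k=1,2,\dots$ compute $d_tu_h^k\in\mathcal{F}_h[u_h^{k-1}]$ such that, with $u_h^k=u_h^{k-1}+\tau d_tu_h^k$, $$(d_tu_h^k,v_h)_*+([u_h^k]'',v_h'')+\varepsilon^{-1}(u_{h,3}^k-\delta,v_{h,3})_h=\varepsilon^{-1}\big((u_{h,3}^{k-1}-\delta)_+,v_{h,3}\big)_h$$ for all $v_h\in\mathcal{F}_h[u_h^{k-1}]$. (i) The iteration defines a sequence $(u_h^k)_{k=0,1,\dots}\subset V_h$ such that for every $K\ge0$ $$I_{h,\varepsilon}[u_h^K]+\tau\sum_{k=1}^K\|d_tu_h^k\|_*^2\le I_{h,\varepsilon}[u_h^0]=e_{0,h}.$$ (ii) Assume in addition that $\|v_h'\|_{L_h^\infty}^2\le c_*\|v_h\|_*^2$ for all $v_h\in V_h$ and let $c_{S,2}>0$, $r\ge0$ be such that $|\Phi_S''(s)|\le c_{S,2}(1+|s|^r)$ for all $s\in\mathbb{R}^3$. Then there is a constant $c'>0$, independent of $\tau$ and $K$, such that for every $K\ge0$ $$\max_{k=0,\dots,K}\big\||[u_h^k]'|^2-1\big\|_{L_h^\infty}\le c_*\tau e_{0,h},\qquad\max_{k=0,\dots,K}\|\Phi_S(u_h^k)\|_{L_h^\infty}\le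 c_*c_{S,2}c'\tau e_{0,h}^{r+1}.$$
   Context: The circle $S^1$ is identified with $[0,L]$, $L=2\pi$, with periodic boundary conditions: $L_{\rm bc}[u]=(u(L)-u(0),u'(L)-u'(0))$. $S$ is the unit sphere, $\Phi_S(s)=|s|^2-1$ for $s\in\mathbb{R}^3$. $(\cdot,\cdot)$ is the $L^2(0,L)$ inner product; $(s)_+=\max\{s,0\}$, $(s)_-=\min\{s,0\}$; the subscript $3$ denotes the third component. For a partition $0=z_0<\dots<z_J=L$, $V_h$ is the space of all $v_h\in C^1([0,L];\mathbb{R}^3)$ that are componentwise polynomials of degree at most $3$ on each $[z_{j-1},z_j]$. $\mathcal{I}_h$ denotes the continuous piecewise linear nodal interpolation operator on this partition, $(v,w)_h=\int_0^L\mathcal{I}_h[vw]\,dx$, and $\|v\|_{L_h^\infty}=\max_{j=0,\dots,J}|v(z_j)|$. Further $$\mathcal{A}_h=\{v_h\in V_h:|v_h'(z_j)|=1,\ \Phi_S(v_h(z_j))=0,\ j=0,\dots,J,\ L_{\rm bc}[v_h]=0\},$$ $$\mathcal{F}_h[\widehat u_h]=\{v_h\in V_h:\Phi_S'(\widehat u_h(z_j))\cdot v_h(z_j)=0,\ \widehat u_h'(z_j)\cdot v_h'(z_j)=0,\ j=0,\dots,J,\ L_{\rm bc}[v_h]=0\},$$ $$I_{h,\varepsilon}[u_h]=\frac12\int_0^L|u_h''|^2\,dx+\frac1{2\varepsilon}\int_0^L\mathcal{I}_h(u_{h,3}-\delta)_-^2\,dx.$$ *)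

(* Defs.v *)
From HB Require Import structures.
From mathcomp Require Import all_boot all_order all_algebra.
From mathcomp Require Import all_classical all_reals all_analysis.
Set Implicit Arguments.
Unset Strict Implicit.
Unset Printing Implicit Defensive.
Import Order.TTheory GRing.Theory Num.Theory.
Import numFieldNormedType.Exports.
Local Open Scope ring_scope.
Local Open Scope classical_set_scope.

Definition len {R : realType} : R := 2 * pi.

Definition dot {R : realType} (s t : 'rV[R]_3) : R := \sum_(i < 3) s 0 i * t 0 i.

(* The library norm on matrices is the maximum norm; this is the Euclidean
   norm of a vector, and the Frobenius norm of a matrix. *)
Definition enorm {R : realType} m n (A : 'M[R]_(m, n)) : R :=
  Num.sqrt (\sum_(i < m) \sum_(j < n) A i j ^+ 2).

Definition third {R : realType} (s : 'rV[R]_3) : R := s 0 ord_max.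

Definition pos_part {R : realType} (s : R) : R := Num.max s 0.
Definition neg_part {R : realType} (s : R) : R := Num.min s 0.

Definition grad {R : realType} (f : 'rV[R]_3 -> R) (s : 'rV[R]_3) : 'rV[R]_3 :=
  \row_(i < 3) 'D_('e_i) f s.

Definition hess {R : realType} (f : 'rV[R]_3 -> R) (s : 'rV[R]_3) : 'M[R]_3 :=
  \matrix_(i < 3, j < 3) 'D_('e_i) (fun t => 'D_('e_j) f t) s.

Definition PhiS {R : realType} (s : 'rV[R]_3) : R := enorm s ^+ 2 - 1.

(* Elements of C^1([0,L];R^3) are represented by C^1 functions on the whole
   line (every C^1 function on [0,L] extends), so that derive1 v at 0 and L is the
   one-sided derivative of the restriction; two representatives denote the
   same element when they agree on [0,L]. *)
Definition eq0L {R : realType} (v w : R -> 'rV[R]_3) : Prop :=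
  forall x, 0 <= x <= len -> v x = w x.

Definition C1 {R : realType} (v : R -> 'rV[R]_3) : Prop :=
  (forall x, derivable v x 1) /\ continuous (derive1 v).

(* Only the values z 0, ..., z J are relevant. *)
Definition is_partition {R : realType} (J : nat) (z : nat -> R) : Prop :=
  [/\ z 0%N = 0, z J = len & forall j, (j < J)%N -> z j < z j.+1].

Definition Vh {R : realType} (J : nat) (z : nat -> R) : set (R -> 'rV[R]_3) :=
  [set v | C1 v /\
    forall (j : nat) (i : 'I_3), (j < J)%N -> exists p : {poly R},
      (size p <= 4)%N /\ forall x, z j <= x <= z j.+1 -> v x 0 i = p.[x]].

(* Nodal interpolation on [0,L]; at a common endpoint of two cells both
   formulas give the nodal value. *)
Definition interp {R : realType} (J : nat) (z : nat -> R) (phi : R -> R) (x : R) : R :=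
  if [pick j : 'I_J | z j <= x <= z j.+1] is Some j
  then phi (z j) + (phi (z j.+1) - phi (z j)) * ((x - z j) / (z j.+1 - z j))
  else 0.

Definition L2inner {R : realType} (f g : R -> 'rV[R]_3) : R :=
  \int[@lebesgue_measure R]_(x in `[0, len]) dot (f x) (g x).

Definition innerh {R : realType} (J : nat) (z : nat -> R) (phi psi : R -> R) : R :=
  \int[@lebesgue_measure R]_(x in `[0, len])
    interp J z (fun y => phi y * psi y) x.

Definition Lhinf {R : realType} (J : nat) (z : nat -> R) (phi : R -> R) : R :=
  \big[Num.max/0]_(j < J.+1) `|phi (z j)|.

Definition Lbc {R : realType} (v : R -> 'rV[R]_3) : 'rV[R]_3 * 'rV[R]_3 :=
  (v len - v 0, derive1 v len - derive1 v 0).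

Definition Ah {R : realType} (J : nat) (z : nat -> R) : set (R -> 'rV[R]_3) :=
  [set v | [/\ Vh J z v,
    forall j, (j <= J)%N -> enorm (derive1 v (z j)) = 1 /\ PhiS (v (z j)) = 0
    & Lbc v = 0]].

Definition Fh {R : realType} (J : nat) (z : nat -> R) (uhat : R -> 'rV[R]_3) :
    set (R -> 'rV[R]_3) :=
  [set v | [/\ Vh J z v,
    forall j, (j <= J)%N -> dot (grad PhiS (uhat (z j))) (v (z j)) = 0
                         /\ dot (derive1 uhat (z j)) (derive1 v (z j)) = 0
    & Lbc v = 0]].

(* derive1n 2 u may be undefined at the nodes, a null set. *)
Definition energy {R : realType} (J : nat) (z : nat -> R) (delta eps : R)
    (u : R -> 'rV[R]_3) : R :=
  2^-1 * (\int[@lebesgue_measure R]_(x in `[0, len]) enorm (derive1n 2 u x) ^+ 2)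
  + (2 * eps)^-1 * (\int[@lebesgue_measure R]_(x in `[0, len])
      interp J z (fun y => neg_part (third (u y) - delta) ^+ 2) x).

(* The first clause says that the form only depends on the elements of the
   space, not on their representatives outside [0,L]. *)
Definition is_inner_product {R : realType} (V : set (R -> 'rV[R]_3))
    (star : (R -> 'rV[R]_3) -> (R -> 'rV[R]_3) -> R) : Prop :=
  [/\ forall v v' w, V v -> V v' -> V w -> eq0L v v' -> star v w = star v' w,
      forall a v v' w, V v -> V v' -> V w ->
        star (a *: v + v') w = a * star v w + star v' w,
      forall v w, V v -> V w -> star v w = star w v
    & forall v, V v -> ~ eq0L v 0 -> 0 < star v v].

Definition star_norm {R : realType}
    (star : (R -> 'rV[R]_3) -> (R -> 'rV[R]_3) -> R) (v : R -> 'rV[R]_3) : R :=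
  Num.sqrt (star v v).

Definition flow_equation {R : realType} (J : nat) (z : nat -> R)
    (delta eps : R) (star : (R -> 'rV[R]_3) -> (R -> 'rV[R]_3) -> R)
    (uold unew d v : R -> 'rV[R]_3) : Prop :=
  star d v + L2inner (derive1n 2 unew) (derive1n 2 v)
    + eps^-1 * innerh J z (fun x => third (unew x) - delta) (fun x => third (v x))
  = eps^-1 * innerh J z (fun x => pos_part (third (uold x) - delta))
                        (fun x => third (v x)).

(* [u 0, ..., u K] and [d 1, ..., d K] are produced by K steps from u0;
   d k stands for the discrete time derivative d_t u_h^k. *)
Definition sheet_flow {R : realType} (J : nat) (z : nat -> R)
    (delta eps tau : R) (star : (R -> 'rV[R]_3) -> (R -> 'rV[R]_3) -> R)
    (u0 : R -> 'rV[R]_3) (K : nat) (u d : nat -> R -> 'rV[R]_3) : Prop :=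
  u 0%N = u0 /\
  forall k, (1 <= k <= K)%N ->
    [/\ Fh J z (u k.-1) (d k),
        u k = u k.-1 + tau *: d k
      & forall v, Fh J z (u k.-1) v ->
          flow_equation J z delta eps star (u k.-1) (u k) (d k) v].

(* Main.v *)
Require Import Defs.
From mathcomp Require Import all_boot all_order all_algebra.
From mathcomp Require Import all_classical all_reals all_analysis.
From mathcomp Require Import ring lra.
Import Order.TTheory GRing.Theory Num.Theory.
Import numFieldNormedType.Exports.
Local Open Scope ring_scope.
Local Open Scope classical_set_scope.

(** Each step of the iteration is a linear problem: find $d$ in the space $F$ of
directions tangential at the nodes such that $a(d,v)=l(v)$ for $v$ in $F$, with
$a(d,v)=(d,v)_*+\tau(d'',v'')+\tau\varepsilon^{-1}(d_3,v_3)_h$.  This form is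
positive definite and $F$ is finite dimensional once functions that agree on
$[0,L]$ are identified, so there is exactly one solution
([flow_step_exists], [flow_step_unique]).  Finite dimensionality enters through
[representation_on_subspace], where a finite list of functionals separates the
elements; for piecewise cubics these are the values at four points of each
cell ([sample_unisolvent]).  This route needs no basis and no quotient space.

The energy decays because the scheme treats the convex part of the energy
implicitly and the concave part explicitly: $\frac12(s-\delta)_-^2$ equals
$\frac12(s-\delta)^2-\frac12(s-\delta)_+^2$, where the first term appears at
the new time and the second one at the old time ([obstacle_splitting]).
Testing the equation with $v=d_tu_h^k$ then bounds the increase of the energy
by $-\tau\|d_tu_h^k\|_*^2$ ([energy_step]), and the sum telescopes
([sheet_flow_energy]).

Both constraints are quadratic, and the update is orthogonal to their gradients
at the old iterate.  Hence $|u_h^k|^2-1$ and $|[u_h^k]'|^2-1$ at a node are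
exactly $\tau^2$ times the sum of the squared updates
([sheet_flow_nodal]).  The energy estimate bounds $\tau$ times the sum of the
$\|d_tu_h^k\|_*^2$ by the initial energy, which leaves one factor $\tau$, as
soon as nodal values are controlled by the norm $\|\cdot\|_*$
([sheet_flow_sup_bound]).  For derivatives this is the assumed inverse
estimate.  For the values it is the Cauchy-Schwarz inequality applied to the
representatives of the nodal evaluations with respect to $(\cdot,\cdot)_*$
([nodal_bound]).  The constant obtained this way depends on the space and the
inner product; since the initial energy is fixed as well, a positive power of
it can be traded for a change of $c'$, which gives the power $r+1$; if the
initial energy vanishes, then so do both bounds. *)

(** * Linear problems on a finite-dimensional space of functions *)

(** A Lax-Milgram lemma for a space $F$ on which finitely many functionals
$\phi_i$ separate points up to the null space of $a$ and $l$.  Induction on the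
list of functionals: on the hyperplane $\phi_i=0$ the problem is solvable, and
if the hyperplane is proper, some $w$ outside it can be made $a$-orthogonal to
it by subtracting a representative of $a(w,\cdot)$; the solution on $F$ is then
a correction of the one on the hyperplane by a multiple of that vector. *)
Lemma representation_on_subspace (R : fieldType) (V : lmodType R) (I : eqType)
    (phi : I -> V -> R) (a : V -> V -> R) (s : seq I) :
  (forall i c u v, phi i (c *: u + v) = c * phi i u + phi i v) ->
  forall (F : set V) (l : V -> R),
  F 0 -> (forall c u v, F u -> F v -> F (c *: u + v)) ->
  (forall c u v w, F u -> F v -> F w ->
    a (c *: u + v) w = c * a u w + a v w) ->
  (forall c u v w, F u -> F v -> F w ->
    a w (c *: u + v) = c * a w u + a w v) ->
  (forall v, F v -> (exists2 i, i \in s & phi i v != 0) -> a v v != 0) ->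
  (forall u v, F u -> F v -> (forall i, i \in s -> phi i v = 0) -> a u v = 0) ->
  (forall c u v, F u -> F v -> l (c *: u + v) = c * l u + l v) ->
  (forall v, F v -> (forall i, i \in s -> phi i v = 0) -> l v = 0) ->
  exists2 d, F d & forall v, F v -> a d v = l v.
Proof.
move=> philin; elim: s => [|i s IH] F l F0 Flin al ar apos a0 llin l0.
  by exists 0 => // v Fv; rewrite l0 // a0.
pose F' := [set v | F v /\ phi i v = 0].
have phi0 : phi i 0 = 0.
  have := philin i 1 0 0; rewrite scaler0 addr0 mul1r => /eqP.
  by rewrite addrC -subr_eq subrr => /eqP.
have F'F v : F' v -> F v by case.
have onF' l' : (forall c u v, F u -> F v -> l' (c *: u + v) = c * l' u + l' v) ->
    (forall v, F v -> (forall j, j \in i :: s -> phi j v = 0) -> l' v = 0) ->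
    exists2 d, F' d & forall v, F' v -> a d v = l' v.
  have cons0 v : phi i v = 0 -> (forall j, j \in s -> phi j v = 0) ->
      forall j, j \in i :: s -> phi j v = 0.
    by move=> iv sv j; rewrite inE => /predU1P[->//|/sv].
  move=> l'lin l'0; apply: IH => //.
  - move=> c u v [Fu iu] [Fv iv]; split; first exact: Flin.
    by rewrite philin iu iv mulr0 addr0.
  - by move=> c u v w /F'F ? /F'F ? /F'F ?; exact: al.
  - by move=> c u v w /F'F ? /F'F ? /F'F ?; exact: ar.
  - move=> v /F'F Fv [j js jv]; apply: apos => //.
    by exists j => //; rewrite inE js orbT.
  - by move=> u v /F'F Fu [Fv iv] sv; apply: a0 => //; exact: cons0.
  - by move=> c u v /F'F ? /F'F ?; exact: l'lin.
  - by move=> v [Fv iv] sv; apply: l'0 => //; exact: cons0.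
have [d' Fd' d'P] := onF' l llin l0.
have [FF'|] := pselect (forall v, F v -> phi i v = 0).
  by exists d' => [|v Fv]; [exact: F'F|apply: d'P; split=> //; exact: FF'].
move=> /existsNP[w /not_implyP[Fw /eqP iw]].
have [p Fp pP] := onF' (a w) (fun c u v Fu Fv => ar c u v w Fu Fv Fw)
  (fun v Fv => a0 w v Fw Fv).
(* [e] is [w] minus its projection, so it is orthogonal to the hyperplane. *)
pose e := (-1) *: p + w.
have Fe : F e by apply: Flin => //; exact: F'F.
have ie : phi i e = phi i w by rewrite philin Fp.2 mulr0 add0r.
have aee : a e e != 0.
  by apply: apos => //; exists i; [rewrite inE eqxx|rewrite ie].
have ae v : F' v -> a e v = 0.
  move=> F'v; rewrite al //; [|exact: F'F..].
  by rewrite pP // mulN1r addNr.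
pose c := (l e - a d' e) / a e e.
exists (c *: e + d') => [|v Fv]; first by apply: Flin => //; exact: F'F.
have [t [v' Fv' ->]] : exists t, exists2 v', F' v' & v = t *: e + v'.
  exists (phi i v / phi i e), ((- (phi i v / phi i e)) *: e + v).
    split; first exact: Flin.
    by rewrite philin mulNr divfK ?ie // addNr.
  by rewrite addrA -scalerDl subrr scale0r add0r.
clearbody e; have Fv'' := F'F _ Fv'.
rewrite ar //; last by apply: Flin => //; exact: F'F.
rewrite llin // !al //; [|exact: F'F..].
rewrite (ae v' Fv') (d'P v' Fv') mulr0 add0r; congr (_ * _ + _).
by rewrite /c divfK // subrK.
Qed.

(** * The partition and functions that are polynomial on its cells *)

Lemma len_gt0 (R : realType) : 0 < len :> R.
Proof. by rewrite mulr_gt0 ?ltr0n ?pi_gt0. Qed.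

Section mesh.
Context (R : realType) (J : nat) (z : nat -> R) (hz : is_partition J z).
Let mu := @lebesgue_measure R.
Let D : set R := `[0, len].

Lemma node_mono i j : (i <= j <= J)%N -> z i <= z j.
Proof.
case/andP => ij jJ; case: hz => _ _ zS.
elim: j ij jJ => [|j IH]; first by rewrite leqn0 => /eqP->.
rewrite leq_eqVlt => /predU1P[->//|ij] jJ.
by apply: le_trans (IH ij (ltnW jJ)) (ltW (zS _ jJ)).
Qed.

Lemma node_in j : (j <= J)%N -> 0 <= z j <= len.
Proof.
case: hz => z0 zJ _ jJ.
by rewrite -{1}z0 -zJ !node_mono ?leqnn ?jJ.
Qed.

Lemma cell_in j x : (j < J)%N -> z j <= x <= z j.+1 -> 0 <= x <= len.
Proof.
move=> jJ /andP[jx xj].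
have /andP[z0 _] := node_in j (ltnW jJ); have /andP[_ zl] := node_in j.+1 jJ.
by rewrite (le_trans z0 jx) (le_trans xj zl).
Qed.

Lemma cell_cover x : 0 <= x <= len -> 
  exists2 j, (j < J)%N & z j <= x <= z j.+1.
Proof.
case: hz => z0 zJ _ /andP[x0 xl].
have J0 : (0 < J)%N.
  rewrite lt0n; apply/eqP => J0; move: zJ; rewrite J0 z0 => /eqP.
  by rewrite lt_eqF // len_gt0.
suff H k : (k < J)%N -> x <= z k.+1 -> exists2 j, (j < J)%N & z j <= x <= z j.+1.
  by apply: (H J.-1); rewrite prednK // zJ.
elim: k => [|k IH] kJ xk; first by exists 0%N; rewrite // z0 x0.
have [xk'|/ltW kx] := leP x (z k.+1); first exact: IH (ltnW kJ) xk'.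
by exists k.+1; rewrite // kx.
Qed.

Lemma cell_uniq i j x : (i < J)%N -> (j < J)%N ->
  z i <= x <= z i.+1 -> z j < x < z j.+1 -> i = j.
Proof.
move=> iJ jJ /andP[ix xi] /andP[jx xj]; case: (ltngtP i j) => // ij.
  have zij : z i.+1 <= z j by apply: node_mono; rewrite ij ltnW.
  by have := lt_le_trans jx (le_trans xi zij); rewrite ltxx.
have zji : z j.+1 <= z i by apply: node_mono; rewrite ij ltnW.
by have := lt_le_trans xj (le_trans zji ix); rewrite ltxx.
Qed.

(** The cells are open because second derivatives of splines may jump or fail to
exist at the nodes. *)
Definition cellwise_poly (f : R -> R) := forall j, (j < J)%N ->
  exists p : {poly R}, forall x, z j < x < z j.+1 -> f x = p.[x].

Let N : set R := [set z j | j in `I_J.+1].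

Let mD : measurable D. Proof. exact: measurable_itv. Qed.

Let countN : countable N.
Proof. by apply: finite_set_countable; apply: finite_image; exact: finite_II. Qed.

Let negligible_nodes : measurable N /\ mu N = 0%E.
Proof.
by split; [exact: countable_measurable|exact: countable_lebesgue_measure0].
Qed.

Let off_nodes x : (D `\` N) x -> exists2 j, (j < J)%N & z j < x < z j.+1.
Proof.
case; rewrite /D /= in_itv /= => /cell_cover[j jJ /andP[zx xz]] Nx.
exists j => //; rewrite !lt_neqAle zx xz !andbT.
by apply/andP; split; apply/eqP => E; apply: Nx;
  [exists j => //=; exact: ltnW|exists j.+1].
Qed.

(** Away from the null set of nodes the function is a finite sum of polynomials
restricted to cells; on the countable set of nodes every function is
measurable. *)
Lemma cellwise_poly_integrable f : cellwise_poly f -> mu.-integrable D (EFin \o f).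
Proof.
move=> fcell; have [mN muN] := negligible_nodes.
have /choice[p fp] j : exists p : {poly R}, (j < J)%N ->
    forall x, z j < x < z j.+1 -> f x = p.[x].
  have [/fcell[p fp]|_] := ltnP j J; last by exists 0.
  by exists p.
pose g x := \sum_(j < J) (p j).[x] * \1_(`]z j, z j.+1[) x.
have iDN : mu.-integrable (D `\` N) (EFin \o f).
  apply: (@eq_integrable _ _ _ mu _ _ (EFin \o g)); first exact: measurableD.
    move=> x /set_mem DNx; have [j jJ xj] := off_nodes x DNx.
    rewrite /= (fp j) // /g (bigD1 (Ordinal jJ)) //= big1 ?addr0.
      by rewrite indicE mem_set ?mulr1 //= in_itv.
    move=> i ij; rewrite indicE memNset ?mulr0 //= in_itv /= => /andP[ix xi].
    case/eqP: ij; apply/val_inj/(cell_uniq i j x) => //=.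
    by rewrite !ltW.
  apply: (@integrableS _ _ _ mu D) => //; first exact: measurableD.
  rewrite (_ : _ \o _ = fun x => (\sum_(j < J) ((p j).[x] * \1_(`]z j, z j.+1[) x)%:E)%E).
    apply: integrable_sum => //= j _.
    rewrite (_ : (fun x => _) = ((EFin \o horner (p j)) \_ `]z j, z j.+1[)); last first.
      by apply/funext => x; rewrite /patch indicE; case: ifPn => _; rewrite ?mulr1 ?mulr0.
    apply/integrable_restrict => //.
    apply: (@integrableS _ _ _ mu D) => //; first exact: measurableI.
    apply: continuous_compact_integrable; first exact: segment_compact.
    apply: continuous_subspaceT => x; exact: continuous_horner.
  by apply/funext => x; rewrite /= /g sumEFin.
apply: ((@negligible_integrable _ _ _ (@lebesgue_measure R) _ _ _ mN mD _ muN).2 iDN).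
rewrite -(setUIDK D N).
apply/measurable_funU; [exact: measurableI|exact: measurableD|split].
  move=> _ Y _; apply: countable_measurable => //.
  apply: (@sub_countable _ _ _ N) countN.
  by apply: subset_card_le => x [[]].
exact: (measurable_int mu).
Qed.

Lemma cellwise_poly_Rintegral_eq f g : cellwise_poly f ->
  (forall j x, (j < J)%N -> z j < x < z j.+1 -> f x = g x) ->
  \int[mu]_(x in D) f x = \int[mu]_(x in D) g x.
Proof.
move=> fp fg; have [mN muN] := negligible_nodes.
have gp : cellwise_poly g.
  move=> j jJ; have [p fpj] := fp j jJ.
  by exists p => x xj; rewrite -(fg _ _ jJ xj) fpj.
have drop h : cellwise_poly h -> (\int[mu]_(x in D) (h x)%:E =
    \int[mu]_(x in D `\` N) (h x)%:E)%E.
  move=> /cellwise_poly_integrable hi.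
  exact: (@negligible_integral _ _ _ (@lebesgue_measure R) _ _ _ mN mD hi muN).
rewrite /Rintegral (drop f fp) (drop g gp).
congr fine; apply: eq_integral => x /set_mem DNx.
by have [j jJ xj] := off_nodes x DNx; rewrite /= (fg j).
Qed.

Lemma cellwise_poly_linear c f g : cellwise_poly f -> cellwise_poly g ->
  cellwise_poly (fun x => c * f x + g x) /\
  \int[mu]_(x in D) (c * f x + g x) =
    c * (\int[mu]_(x in D) f x) + \int[mu]_(x in D) g x.
Proof.
move=> fp gp; have lin c' h : cellwise_poly h -> cellwise_poly (fun x => c' * f x + h x).
  move=> hp j jJ; have [p fpj] := fp j jJ; have [q hq] := hp j jJ.
  by exists (c' *: p + q) => x xj; rewrite hornerD hornerZ fpj ?hq.
split; first exact: lin.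
rewrite RintegralD //; last exact: cellwise_poly_integrable; last first.
  apply: cellwise_poly_integrable => j jJ; have [p fpj] := fp j jJ.
  by exists (c *: p) => x xj; rewrite hornerZ fpj.
by rewrite RintegralZl //; exact: cellwise_poly_integrable.
Qed.

(** * The spline space and the bending form *)

(** The derivative is a limit of vector-valued difference quotients, so the
componentwise formula uses that the curve is polynomial in a neighbourhood of
the point, hence the open interval. *)
Lemma derive1_on_interval (v : R -> 'rV[R]_3) (p : 'I_3 -> {poly R}) a b :
  (forall x i, a < x < b -> v x 0 i = (p i).[x]) ->
  forall x i, a < x < b -> derive1 v x 0 i = ((p i)^`()).[x].
Proof.
move=> vp x i xab; pose q y : 'rV[R]_3 := \row_i (p i).[y].
have vq : \near x, v x = q x.
  have : \forall y \near x, y \in `]a, b[%R by apply: near_in_itvoo; rewrite in_itv.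
  apply: filterS => y; rewrite in_itv /= => yab.
  by apply/rowP => k; rewrite vp // mxE.
have coord k l : (fun y => q y k l) = horner (p l).
  by apply/funext => y; rewrite mxE.
rewrite derive1E (near_eq_derive _ vq) derive_mx; last first.
  by apply/derivable_mxP => k l; rewrite coord; exact: derivable_horner.
by rewrite mxE coord derivE derive1E.
Qed.

Lemma derive1n2_on_interval (v : R -> 'rV[R]_3) (p : 'I_3 -> {poly R}) a b :
  (forall x i, a <= x <= b -> v x 0 i = (p i).[x]) ->
  forall x i, a < x < b -> derive1n 2 v x 0 i = ((p i)^`()^`()).[x].
Proof.
move=> vp; do 2!apply: derive1_on_interval; move=> x i /andP[ax xb].
by rewrite vp // !ltW.
Qed.

Lemma Vh_on_cell v j : Vh J z v -> (j < J)%N -> exists p : 'I_3 -> {poly R},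
  (forall i, (size (p i) <= 4)%N) /\
  (forall x i, z j <= x <= z j.+1 -> v x 0 i = (p i).[x]).
Proof.
move=> [_ vp] jJ; have /choice[p pP] := fun i => vp j i jJ.
by exists p; split => [i|x i]; [case: (pP i)|exact: (pP i).2].
Qed.

Lemma derive1_linear c (u v : R -> 'rV[R]_3) : C1 u -> C1 v ->
  derive1 (c *: u + v) = c *: derive1 u + derive1 v.
Proof.
move=> [du _] [dv _]; apply/funext => x.
by rewrite !fctE !derive1E deriveD // ?deriveZ //; exact: derivableZ.
Qed.

Lemma Vh_linear c u v : Vh J z u -> Vh J z v -> Vh J z (c *: u + v).
Proof.
move=> [uC up] [vC vp]; split.
  split=> [x|]; first by apply: derivableD; [apply: derivableZ; exact: uC.1|exact: vC.1].
  rewrite derive1_linear // => x; apply: cvgD; last exact: vC.2.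
  by apply: cvgZl_tmp; exact: uC.2.
move=> j i jJ; have [p [p4 pu]] := up j i jJ; have [q [q4 qv]] := vp j i jJ.
exists (c *: p + q); split=> [|x xj].
  by rewrite (leq_trans (size_polyD _ _)) // geq_max q4 (leq_trans (size_scale_leq _ _)).
by rewrite !fctE !mxE pu // qv // hornerD hornerZ.
Qed.

Lemma Vh0 : Vh J z 0.
Proof.
split.
  split=> [x|]; first exact: (derivable_cst 0).
  rewrite (_ : derive1 _ = cst 0); first exact: cst_continuous.
  by apply/funext => x; rewrite (derive1_cst 0).
move=> j i jJ; exists 0; rewrite size_poly0; split=> // x _.
by rewrite mxE horner0.
Qed.

Lemma dotC (s t : 'rV[R]_3) : dot s t = dot t s.
Proof. by apply: eq_bigr => i _; rewrite mulrC. Qed.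

Lemma dot_linear c (s t w : 'rV[R]_3) : dot (c *: s + t) w = c * dot s w + dot t w.
Proof.
rewrite /dot mulr_sumr -big_split /=; apply: eq_bigr => i _.
by rewrite !mxE mulrDl mulrA.
Qed.

Lemma dot_linear_r c (s t w : 'rV[R]_3) : dot w (c *: s + t) = c * dot w s + dot w t.
Proof. by rewrite dotC dot_linear (dotC s) (dotC t). Qed.

Lemma enorm_sqr (s : 'rV[R]_3) : enorm s ^+ 2 = dot s s.
Proof.
rewrite /enorm big_ord1 sqr_sqrtr; first by apply: eq_bigr => i _; rewrite expr2.
by apply: sumr_ge0 => i _; exact: sqr_ge0.
Qed.

Lemma dot_ge0 (s : 'rV[R]_3) : 0 <= dot s s.
Proof. by rewrite -enorm_sqr sqr_ge0. Qed.

Definition bending u v := L2inner (derive1n 2 u) (derive1n 2 v) : R.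

Lemma bending_cellwise u v : Vh J z u -> Vh J z v ->
  cellwise_poly (fun x => dot (derive1n 2 u x) (derive1n 2 v x)).
Proof.
move=> uV vV j jJ; have [p [_ up]] := Vh_on_cell u j uV jJ.
have [q [_ vq]] := Vh_on_cell v j vV jJ.
exists (\sum_(i < 3) (p i)^`()^`() * (q i)^`()^`()) => x xj.
rewrite horner_sum; apply: eq_bigr => i _; rewrite hornerM.
congr (_ * _); first exact: (derive1n2_on_interval _ _ _ _ up).
exact: (derive1n2_on_interval _ _ _ _ vq).
Qed.

Lemma bendingE u v : L2inner (derive1n 2 u) (derive1n 2 v) = bending u v.
Proof. by []. Qed.

Lemma bendingC u v : bending u v = bending v u.
Proof. by apply: eq_Rintegral => x _; exact: dotC. Qed.

Lemma bending_ge0 u : 0 <= bending u u.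
Proof. by apply: Rintegral_ge0 => x _; exact: dot_ge0. Qed.

Lemma bending_linear c u v w : Vh J z u -> Vh J z v -> Vh J z w ->
  bending (c *: u + v) w = c * bending u w + bending v w.
Proof.
move=> uV vV wV; have uw := bending_cellwise u w uV wV.
have vw := bending_cellwise v w vV wV.
rewrite -(cellwise_poly_linear c _ _ uw vw).2; apply: cellwise_poly_Rintegral_eq.
  exact: bending_cellwise (Vh_linear c u v uV vV) wV.
move=> j x jJ xj; rewrite -dot_linear; congr dot; apply/rowP => i.
have [p [_ up]] := Vh_on_cell u j uV jJ; have [q [_ vq]] := Vh_on_cell v j vV jJ.
have uvp y k : z j <= y <= z j.+1 -> (c *: u + v) y 0 k = (c *: p k + q k).[y].
  by move=> yj; rewrite !fctE !mxE up // vq // hornerD hornerZ.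
apply: (etrans (derive1n2_on_interval _ (fun k => c *: p k + q k) _ _ uvp _ _ xj)).
rewrite !mxE !derivD !derivZ hornerD hornerZ; congr (_ * _ + _).
  exact/esym/(derive1n2_on_interval _ _ _ _ up).
exact/esym/(derive1n2_on_interval _ _ _ _ vq).
Qed.

(** Functions that agree on the closed cell have the same polynomial there, so the
form does not see the extension of its arguments to the line. *)
Lemma bending_eq0L u u' w : Vh J z u -> Vh J z u' -> Vh J z w -> eq0L u u' ->
  bending u w = bending u' w.
Proof.
move=> uV u'V wV uu'; apply: cellwise_poly_Rintegral_eq.
  exact: bending_cellwise.
move=> j x jJ xj; have [p [_ up]] := Vh_on_cell u j uV jJ.
have u'p y k : z j <= y <= z j.+1 -> u' y 0 k = (p k).[y].
  by move=> yj; rewrite -uu' ?up //; exact: (cell_in j).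
have uu'2 i : derive1n 2 u x 0 i = derive1n 2 u' x 0 i.
  apply: (etrans (derive1n2_on_interval _ _ _ _ up _ _ xj)).
  exact/esym/(derive1n2_on_interval _ _ _ _ u'p).
by apply: eq_bigr => i _; exact: (congr1 (fun r => r * _) (uu'2 i)).
Qed.

(** * Numerical quadrature at the nodes *)

Definition lumped (f : R -> R) : R := \int[mu]_(x in D) interp J z f x.

Lemma interp_cellwise f : cellwise_poly (interp J z f).
Proof.
move=> j jJ.
pose m := (f (z j.+1) - f (z j)) / (z j.+1 - z j).
exists ((f (z j))%:P + m *: ('X - (z j)%:P)) => x xj.
rewrite /interp; case: pickP => [i xi|/(_ (Ordinal jJ))]; last first.
  by case/andP: xj => ? ?; rewrite /= !ltW.
rewrite (cell_uniq i j x (ltn_ord i) jJ xi xj).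
by rewrite hornerD hornerC hornerZ hornerXsubC /m; ring.
Qed.

Lemma interp_linear c f g x :
  interp J z (fun y => c * f y + g y) x = c * interp J z f x + interp J z g x.
Proof. by rewrite /interp; case: pickP => [i _|_]; ring. Qed.

Lemma lumped_linear c f g :
  lumped (fun y => c * f y + g y) = c * lumped f + lumped g.
Proof.
rewrite /lumped -(cellwise_poly_linear c _ _ (interp_cellwise f) (interp_cellwise g)).2.
by apply: eq_Rintegral => x _; exact: interp_linear.
Qed.

Lemma lumped_eq f g : (forall j, (j <= J)%N -> f (z j) = g (z j)) ->
  lumped f = lumped g.
Proof.
move=> fg; apply: eq_Rintegral => x _; rewrite /interp.
by case: pickP => // i _; rewrite !fg // ltnW.
Qed.

Lemma lumped_null f : (forall j, (j <= J)%N -> f (z j) = 0) -> lumped f = 0.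
Proof.
move=> f0; rewrite (_ : lumped f = lumped (fun y => -1 * f y + f y)).
  by rewrite lumped_linear mulN1r addNr.
by apply: lumped_eq => j jJ; rewrite f0 // mulr0 addr0.
Qed.

(** On each cell the interpolant is a convex combination of two nodal values. *)
Lemma lumped_ge0 f : (forall j, (j <= J)%N -> 0 <= f (z j)) -> 0 <= lumped f.
Proof.
move=> f0; apply: Rintegral_ge0 => x _; rewrite /interp.
case: pickP => // i /andP[ix xi]; have [_ _ /(_ i (ltn_ord i)) zi] := hz.
set t := (x - _) / _; have t0 : 0 <= t.
  by rewrite divr_ge0 // subr_ge0 // ltW.
have t1 : t <= 1 by rewrite ler_pdivrMr ?subr_gt0 // mul1r lerB.
have fi := f0 i (ltnW (ltn_ord i)); have fi1 := f0 i.+1 (ltn_ord i).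
have -> : f (z i) + (f (z i.+1) - f (z i)) * t = f (z i) * (1 - t) + f (z i.+1) * t.
  by ring.
by rewrite addr_ge0 // mulr_ge0 // subr_ge0.
Qed.

Lemma lumped_le f g : (forall j, (j <= J)%N -> f (z j) <= g (z j)) ->
  lumped f <= lumped g.
Proof.
move=> fg; rewrite -subr_ge0 addrC -mulN1r -lumped_linear; apply: lumped_ge0.
by move=> j jJ; rewrite mulN1r addrC subr_ge0 fg.
Qed.

(** * Separation of splines, and derivatives at the nodes *)

(** Four equidistant points per cell, endpoints included, determine a cubic. *)
Definition sample (k : 'I_J * 'I_4 * 'I_3) (v : R -> 'rV[R]_3) : R :=
  v (z k.1.1 + k.1.2%:R / 3 * (z k.1.1.+1 - z k.1.1)) 0 k.2.

Lemma sample_linear k c u v : sample k (c *: u + v) = c * sample k u + sample k v.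
Proof. by rewrite /sample !fctE !mxE. Qed.

Lemma sample_point_in_cell (j : 'I_J) (m : 'I_4) :
  z j <= z j + m%:R / 3 * (z j.+1 - z j) <= z j.+1.
Proof.
have [_ _ /(_ j (ltn_ord j)) zj] := hz.
have t0 : 0 <= m%:R / 3 :> R by rewrite divr_ge0.
have t1 : m%:R / 3 <= 1 :> R.
  by rewrite ler_pdivrMr ?ltr0n // mul1r ler_nat -ltnS ltn_ord.
set t := m%:R / 3 in t0 t1 *; nra.
Qed.

Lemma eq0L_sample v k : eq0L v 0 -> sample k v = 0.
Proof.
move=> v0; rewrite /sample v0 ?mxE //; apply: (cell_in k.1.1) => //.
exact: sample_point_in_cell.
Qed.

Lemma sample_unisolvent v : Vh J z v -> (forall k, sample k v = 0) -> eq0L v 0.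
Proof.
move=> vV v0 x /cell_cover[j jJ xj]; apply/rowP => i; rewrite mxE.
have [p [p4 vp]] := Vh_on_cell v j vV jJ; rewrite vp //.
have [_ _ /(_ j jJ) zj] := hz.
pose pt (m : 'I_4) := z j + m%:R / 3 * (z j.+1 - z j).
suff -> : p i = 0 by rewrite horner0.
apply: (@roots_geq_poly_eq0 _ _ (map pt (enum 'I_4))).
- apply/allP => _ /mapP[m _ ->]; rewrite /root -vp.
    by have := v0 (Ordinal jJ, m, i); rewrite /sample /= => ->.
  exact: (sample_point_in_cell (Ordinal jJ)).
- rewrite map_inj_uniq ?enum_uniq // => m m' /addrI /mulIf.
  rewrite subr_eq0 gt_eqF // => /(_ isT) /mulIf; rewrite invr_eq0 pnatr_eq0.
  by move=> /(_ isT) /eqP; rewrite eqr_nat => /eqP/val_inj.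
- by rewrite size_map -cardE card_ord p4.
Qed.

(** At an endpoint of $[0,L]$ the derivative of a function on the line is the
limit of the difference quotients from inside the interval, so it only depends
on the restriction. *)
Lemma derive1_eq0L (u u' : R -> 'rV[R]_3) x : C1 u -> C1 u' -> eq0L u u' ->
  0 <= x <= len -> derive1 u x = derive1 u' x.
Proof.
move=> [du _] [du' _] uu' xin.
have key (F : set_system R) : ProperFilter F -> F `=>` (0:R)^' ->
    (\forall h \near F, 0 <= h + x <= len) -> derive1 u x = derive1 u' x.
  move=> FF F0 Fx; rewrite !derive1E.
  have lim_along (w : R -> 'rV[R]_3) : derivable w x 1 ->
      h^-1 *: (w (h *: (1 : R) + x) - w x) @[h --> F] --> 'D_1 w x.
    by move=> dw; apply: cvg_trans dw; exact: cvg_app.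
  have := lim_along u' (du' x); apply: (cvg_unique _ _) => //.
  have := lim_along u (du x); apply: cvg_trans; apply: near_eq_cvg.
  apply: filterS Fx => h hx.
  by rewrite !uu' // [_%:A]mulr1.
case/andP: (xin) => x0 xl; have [xlt|lx] := ltP x len.
  apply: (key (0:R)^'+).
    by move=> A; apply: (@filterS _ (nbhs (0:R))) => h Ah h0; apply: Ah; rewrite /= gt_eqF.
  near=> h; apply/andP; split; first by rewrite addr_ge0.
  by rewrite -lerBrDr; near: h; apply: nbhs_right_le; rewrite subr_gt0.
have xE : x = len by apply/le_anti; rewrite xl lx.
apply: (key (0:R)^'-).
  by move=> A; apply: (@filterS _ (nbhs (0:R))) => h Ah h0; apply: Ah; rewrite /= lt_eqF.
rewrite xE; near=> h; apply/andP; split; last by rewrite gerDr.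
rewrite -lerBlDr sub0r; near: h; apply: nbhs_left_ge.
by rewrite oppr_lt0 len_gt0.
Unshelve. all: by end_near. Qed.

(** * The sphere constraint and the tangential directions *)

Lemma derive_PhiS (s v : 'rV[R]_3) : 'D_v PhiS s = 2 * dot s v.
Proof.
apply: cvg_lim => //.
have lin : 2 * dot s v + h * dot v v @[h --> (0:R)^'] --> 2 * dot s v.
  rewrite -[X in _ --> X]addr0 -[X in _ --> _ + X](mul0r (dot v v)).
  apply: cvgD; first exact: cvg_cst.
  have h0 : h @[h --> (0:R)^'] --> (0:R) by move=> A; exact: nbhs_dnbhs.
  exact: cvgM h0 (cvg_cst _).
apply: cvg_trans lin; apply: near_eq_cvg; near=> h.
have h0 : h != 0 by near: h; exact: nbhs_dnbhs_neq.
rewrite /= /PhiS !enorm_sqr dot_linear !dot_linear_r (dotC v s).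
apply: (mulfI h0); rewrite [in RHS]/GRing.scale /= mulrA divff // mul1r.
by ring.
Unshelve. all: by end_near. Qed.

Lemma dot_grad_PhiS (s v : 'rV[R]_3) : dot (grad PhiS s) v = 2 * dot s v.
Proof.
rewrite /dot mulr_sumr; apply: eq_bigr => i _; rewrite mxE derive_PhiS.
rewrite -mulrA; congr (_ * (_ * _)); rewrite /dot (bigD1 i) //= big1 => [|k ki].
  by rewrite mxE !eqxx mulr1 addr0.
by rewrite mxE (negPf ki) andbF mulr0.
Qed.
Lemma Fh_Vh uhat v : Fh J z uhat v -> Vh J z v. Proof. by case. Qed.

Lemma Fh0 uhat : Fh J z uhat 0.
Proof.
have derive0 (x : R) : derive1 (0 : R -> 'rV[R]_3) x = 0 by exact: derive1_cst.
split; first exact: Vh0.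
  have dot0 (s : 'rV[R]_3) : dot s 0 = 0.
    by apply: big1 => i _; rewrite mxE mulr0.
  by move=> j _; rewrite derive0 !dot0.
by rewrite /Lbc !derive0 !subrr.
Qed.

Lemma Fh_linear uhat c u v :
  Fh J z uhat u -> Fh J z uhat v -> Fh J z uhat (c *: u + v).
Proof.
move=> [uV uz ub] [vV vz vb]; have dl := derive1_linear c u v uV.1 vV.1.
split; first exact: Vh_linear.
  move=> j jJ; have [u1 u2] := uz j jJ; have [v1 v2] := vz j jJ.
  by rewrite dl !fctE !dot_linear_r u1 u2 v1 v2 mulr0 addr0.
case: ub => ub1 ub2; case: vb => vb1 vb2; rewrite /Lbc dl !fctE.
by congr (_, _); rewrite opprD addrACA -scalerBr ?ub1 ?ub2 ?vb1 ?vb2 scaler0 addr0.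
Qed.

Lemma Fh_eq0L u u' v : Vh J z u -> Vh J z u' -> eq0L u u' ->
  Fh J z u v -> Fh J z u' v.
Proof.
move=> uV u'V uu' [vV vz vb]; split=> [//|j jJ|//].
have zin := node_in j jJ; rewrite -(uu' _ zin).
by rewrite -(derive1_eq0L u u' _ uV.1 u'V.1 uu' zin); exact: vz.
Qed.

(** * The inner product of the flow *)

Definition mass (u v : R -> 'rV[R]_3) : R :=
  lumped (fun x => third (u x) * third (v x)).

Lemma mass_linear c u v w : mass (c *: u + v) w = c * mass u w + mass v w.
Proof.
rewrite /mass -lumped_linear; apply: lumped_eq => j _.
by rewrite /third !fctE !mxE; ring.
Qed.

Lemma massC u v : mass u v = mass v u.
Proof. by apply: lumped_eq => j _; rewrite mulrC. Qed.

Lemma mass_ge0 u : 0 <= mass u u.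
Proof. by apply: lumped_ge0 => j _; rewrite -expr2 sqr_ge0. Qed.

Lemma linear_form0 (b : (R -> 'rV[R]_3) -> R) : b (1 *: 0 + 0) = 1 * b 0 + b 0 -> b 0 = 0.
Proof.
by rewrite scaler0 addr0 mul1r => /eqP; rewrite addrC -subr_eq subrr => /eqP.
Qed.

Lemma massE u v : mass u v = lumped (fun x => third (u x) * third (v x)).
Proof. by []. Qed.

Lemma mass_null v w : eq0L v 0 -> mass v w = 0.
Proof.
move=> v0; rewrite (_ : mass v w = mass 0 w).
  exact: (linear_form0 (mass^~ w) (mass_linear 1 0 0 w)).
by apply: lumped_eq => j jJ; rewrite (v0 _ (node_in j jJ)).
Qed.

Context (star : (R -> 'rV[R]_3) -> (R -> 'rV[R]_3) -> R)
  (hstar : is_inner_product (Vh J z) star).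

Lemma star_linear c u v w : Vh J z u -> Vh J z v -> Vh J z w ->
  star (c *: u + v) w = c * star u w + star v w.
Proof. by case: hstar => _ + _ _; apply. Qed.

Lemma starC u v : Vh J z u -> Vh J z v -> star u v = star v u.
Proof. by case: hstar => _ _ + _; apply. Qed.

Lemma star_linear_r c u v w : Vh J z u -> Vh J z v -> Vh J z w ->
  star w (c *: u + v) = c * star w u + star w v.
Proof.
move=> uV vV wV; rewrite (starC w _ wV (Vh_linear c u v uV vV)).
by rewrite (star_linear _ _ _ _ uV vV wV) (starC u w uV wV) (starC v w vV wV).
Qed.

Lemma star_null v w : Vh J z v -> Vh J z w -> eq0L v 0 -> star v w = 0.
Proof.
case: (hstar) => rep _ _ _ vV wV v0; rewrite (rep v 0 w vV Vh0 wV v0).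
by apply: (linear_form0 (star^~ w)); exact: star_linear 1 0 0 w Vh0 Vh0 wV.
Qed.

Lemma star_gt0 v : Vh J z v -> ~ eq0L v 0 -> 0 < star v v.
Proof. by case: hstar => _ _ _; apply. Qed.

Lemma star_ge0 v : Vh J z v -> 0 <= star v v.
Proof.
move=> vV; have [v0|v0] := pselect (eq0L v 0); last exact: ltW (star_gt0 v vV v0).
by rewrite (star_null v v vV vV v0).
Qed.

Lemma star_norm_sqr v : Vh J z v -> star_norm star v ^+ 2 = star v v.
Proof. by move=> vV; rewrite sqr_sqrtr //; exact: star_ge0. Qed.

Lemma star_cauchy_schwarz u v : Vh J z u -> Vh J z v ->
  star u v ^+ 2 <= star u u * star v v.
Proof.
move=> uV vV; have [v0|v0] := pselect (eq0L v 0).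
  rewrite (starC u v uV vV) (star_null v u vV uV v0) expr0n /=.
  by rewrite mulr_ge0 // star_ge0.
have vv := star_gt0 v vV v0.
pose w := (- (star u v / star v v)) *: v + u.
have wV : Vh J z w by exact: Vh_linear.
have := star_ge0 w wV.
rewrite {1}/w (star_linear _ _ _ _ vV uV wV).
rewrite !(star_linear_r _ _ _ _ vV uV) //.
rewrite (starC v u vV uV).
have -> : - (star u v / star v v) * (- (star u v / star v v) * star v v + star u v)
   + (- (star u v / star v v) * star u v + star u u)
   = (star u u * star v v - star u v ^+ 2) / star v v.
  by field; rewrite gt_eqF.
by rewrite pmulr_lge0 ?invr_gt0 // subr_ge0.
Qed.

(** By [representation_on_subspace] each component of the value at a node is
$(g,\cdot)_*$ for some $g$ in the spline space; the Cauchy-Schwarz inequality bounds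
it by $\|g\|_*$, and the squares of these numbers add up to the constant. *)
Lemma nodal_bound : exists2 C : R, 0 < C &
  forall v j, Vh J z v -> (j <= J)%N -> dot (v (z j)) (v (z j)) <= C * star v v.
Proof.
have riesz (ji : 'I_J.+1 * 'I_3) : exists g, Vh J z g /\
    forall v, Vh J z v -> star g v = v (z ji.1) 0 ji.2.
  suff [g gV gP] : exists2 g, Vh J z g &
      forall v, Vh J z v -> star g v = v (z ji.1) 0 ji.2 by exists g.
  apply: (@representation_on_subspace _ _ _ sample star
    (enum {: 'I_J * 'I_4 * 'I_3}) sample_linear).
  - exact: Vh0.
  - by move=> c u v uV vV; exact: Vh_linear.
  - by move=> *; exact: star_linear.
  - by move=> *; exact: star_linear_r.
  - move=> v vV [k _ kv]; rewrite gt_eqF //; apply: star_gt0 => // v0.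
    by move: kv; rewrite eq0L_sample ?eqxx.
  - move=> u v uV vV v0; rewrite (starC u v uV vV); apply: star_null => //.
    by apply: sample_unisolvent => // k; apply: v0; rewrite mem_enum.
  - by move=> c u v _ _; rewrite !fctE !mxE.
  - move=> v vV v0; rewrite (sample_unisolvent v vV) ?mxE //.
      by move=> k; apply: v0; rewrite mem_enum.
    by apply: node_in; rewrite -ltnS ltn_ord.
have [g gP] := choice riesz.
have gg0 ji : 0 <= star (g ji) (g ji) by apply: star_ge0; exact: (gP ji).1.
(* The summand 1 makes the constant positive. *)
exists (1 + \sum_(j < J.+1) \sum_(i < 3) star (g (j, i)) (g (j, i))).
  by apply: ltr_wpDr => //; apply: sumr_ge0 => j _; apply: sumr_ge0.
move=> v j vV jJ; pose j' := @Ordinal J.+1 j jJ; have vv0 := star_ge0 v vV.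
apply: (@le_trans _ _ ((\sum_(i < 3) star (g (j', i)) (g (j', i))) * star v v)).
  rewrite mulr_suml; apply: ler_sum => i _; rewrite -expr2.
  rewrite -((gP (j', i)).2 v vV); apply: star_cauchy_schwarz => //.
  exact: (gP (j', i)).1.
apply: ler_wpM2r => //; apply: ler_wpDl => //.
rewrite (bigD1 j') //= lerDl; apply: sumr_ge0 => k _; exact: sumr_ge0.
Qed.

(** * One step of the flow *)

Context (delta eps tau : R) (heps : 0 < eps) (htau : 0 < tau).

(** Inserting $u_h^k=u_h^{k-1}+\tau d$ moves the contributions of the unknown $d$
to the left-hand side of the equation and those of $u_h^{k-1}$ to the right-hand
side, which is [flow_load]. *)
Definition flow_form d v : R :=
  star d v + tau * bending d v + eps^-1 * tau * mass d v.

Definition flow_load uold v : R :=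
  - bending uold v
  + eps^-1 * lumped (fun x => (pos_part (third (uold x) - delta)
                               - (third (uold x) - delta)) * third (v x)).

Lemma flow_equationE uold d v : Vh J z uold -> Vh J z d -> Vh J z v ->
  flow_equation J z delta eps star uold (uold + tau *: d) d v <->
  flow_form d v = flow_load uold v.
Proof.
move=> uV dV vV.
rewrite /flow_equation /flow_form /flow_load bendingE.
rewrite /innerh -!/(lumped _) (addrC uold) (bending_linear _ _ _ _ dV uV vV).
set m := lumped (fun x => (third ((tau *: d + uold) x) - delta) * third (v x)).
set l := lumped (fun x => pos_part _ * _).
pose o := lumped (fun x => (third (uold x) - delta) * third (v x)).
have -> : m = tau * mass d v + o.
  rewrite massE -lumped_linear; apply: lumped_eq => j _.
  by rewrite /third !fctE !mxE; ring.
have -> : lumped (fun x => (pos_part (third (uold x) - delta)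
    - (third (uold x) - delta)) * third (v x)) = (-1) * o + l.
  by rewrite -lumped_linear; apply: lumped_eq => j _; ring.
have arith (s bd bu md o' l' e t : R) :
    s + (t * bd + bu) + e * (t * md + o') = e * l' <->
    s + t * bd + e * t * md = - bu + e * (- 1 * o' + l').
  by split=> E; lra.
exact: arith.
Qed.

Lemma flow_form_linear c u v w : Vh J z u -> Vh J z v -> Vh J z w ->
  flow_form (c *: u + v) w = c * flow_form u w + flow_form v w.
Proof.
move=> uV vV wV; rewrite /flow_form (star_linear _ _ _ _ uV vV wV).
rewrite (bending_linear _ _ _ _ uV vV wV).
rewrite mass_linear.
have arith (s s' b b' m m' e t : R) :
    (c * s + s') + t * (c * b + b') + e * t * (c * m + m') =
    c * (s + t * b + e * t * m) + (s' + t * b' + e * t * m') by ring.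
exact: arith.
Qed.

Lemma flow_formC u v : Vh J z u -> Vh J z v -> flow_form u v = flow_form v u.
Proof.
by move=> uV vV; rewrite /flow_form (starC u v uV vV) bendingC massC.
Qed.

Lemma flow_form_gt0 v : Vh J z v -> ~ eq0L v 0 -> 0 < flow_form v v.
Proof.
move=> vV v0; rewrite /flow_form -addrA ltr_pwDl ?(star_gt0 v vV v0) //.
by rewrite addr_ge0 // !mulr_ge0 ?invr_ge0 ?bending_ge0 ?mass_ge0 // ltW.
Qed.

Lemma bending_null v w : Vh J z v -> Vh J z w -> eq0L v 0 -> bending v w = 0.
Proof.
move=> vV wV v0; rewrite (bending_eq0L v 0 w vV Vh0 wV v0).
by apply: (linear_form0 (bending^~ w)); exact: bending_linear 1 0 0 w Vh0 Vh0 wV.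
Qed.

Lemma flow_form_null v w : Vh J z v -> Vh J z w -> eq0L v 0 -> flow_form v w = 0.
Proof.
move=> vV wV v0; rewrite /flow_form (star_null v w vV wV v0).
by rewrite (bending_null v w vV wV v0) (mass_null v w v0) !mulr0 !addr0.
Qed.

Lemma flow_load_linear uold c v w : Vh J z uold -> Vh J z v -> Vh J z w ->
  flow_load uold (c *: v + w) = c * flow_load uold v + flow_load uold w.
Proof.
move=> uV vV wV; rewrite /flow_load !(bendingC uold).
rewrite (bending_linear _ _ _ _ vV wV uV).
set l := lumped _; set m := lumped _; set n := lumped _.
have -> : l = c * m + n; last first.
  have arith (b b' m' n' e : R) : - (c * b + b') + e * (c * m' + n') =
    c * (- b + e * m') + (- b' + e * n') by ring.
  exact: arith.
rewrite -lumped_linear; apply: lumped_eq => j _.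
by rewrite /third !fctE !mxE; ring.
Qed.

Lemma flow_load_null uold v : Vh J z uold -> Vh J z v -> eq0L v 0 ->
  flow_load uold v = 0.
Proof.
move=> uV vV v0; rewrite /flow_load bendingC (bending_null v uold vV uV v0).
rewrite lumped_null ?mulr0 ?oppr0 ?addr0 // => j jJ.
by rewrite (v0 _ (node_in j jJ)) /third mxE mulr0.
Qed.

Lemma flow_step_exists uold : Vh J z uold -> exists d, Fh J z uold d /\
  forall v, Fh J z uold v ->
    flow_equation J z delta eps star uold (uold + tau *: d) d v.
Proof.
move=> uV.
suff [d dF dP] : exists2 d, Fh J z uold d &
    forall v, Fh J z uold v -> flow_form d v = flow_load uold v.
  exists d; split=> // v vF; apply/flow_equationE; last exact: dP.
  - exact: uV.
  - exact: Fh_Vh dF.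
  - exact: Fh_Vh vF.
apply: (@representation_on_subspace _ _ _ sample flow_form
    (enum {: 'I_J * 'I_4 * 'I_3}) sample_linear).
- exact: Fh0.
- by move=> c u v uF vF; exact: Fh_linear.
- by move=> c u v w /Fh_Vh ? /Fh_Vh ? /Fh_Vh ?; exact: flow_form_linear.
- move=> c u v w /Fh_Vh uV' /Fh_Vh vV /Fh_Vh wV.
  rewrite (flow_formC w _ wV (Vh_linear c u v uV' vV)).
  rewrite (flow_form_linear _ _ _ _ uV' vV wV).
  by rewrite (flow_formC u w uV' wV) (flow_formC v w vV wV).
- move=> v /Fh_Vh vV [k _ kv]; rewrite gt_eqF //; apply: flow_form_gt0 => // v0.
  by move: kv; rewrite eq0L_sample ?eqxx.
- move=> u v /Fh_Vh uV' /Fh_Vh vV v0; rewrite (flow_formC u v uV' vV).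
  apply: flow_form_null => //.
  by apply: sample_unisolvent => // k; apply: v0; rewrite mem_enum.
- by move=> c u v /Fh_Vh uV' /Fh_Vh vV; exact: flow_load_linear.
- move=> v /Fh_Vh vV v0; apply: flow_load_null => //.
  by apply: sample_unisolvent => // k; apply: v0; rewrite mem_enum.
Qed.
(** The old iterates are only assumed to agree on $[0,L]$, as representatives of
the same spline may differ elsewhere; the difference of two solutions is then
admissible as a test function in both problems and annihilates the positive
definite form. *)
Lemma flow_step_unique u u' d d' : Vh J z u -> Vh J z u' -> eq0L u u' ->
  Fh J z u d -> Fh J z u' d' ->
  (forall v, Fh J z u v ->
    flow_equation J z delta eps star u (u + tau *: d) d v) ->
  (forall v, Fh J z u' v ->
    flow_equation J z delta eps star u' (u' + tau *: d') d' v) ->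
  eq0L d d'.
Proof.
move=> uV u'V uu' dF d'F eqd eqd'.
have u'u : eq0L u' u by move=> x xin; rewrite uu'.
have dV := Fh_Vh _ _ dF; have d'V := Fh_Vh _ _ d'F.
pose e := (-1) *: d' + d.
have eF : Fh J z u e := Fh_linear _ _ _ _ (Fh_eq0L _ _ _ u'V uV u'u d'F) dF.
have eF' : Fh J z u' e by exact: Fh_eq0L uV u'V uu' eF.
have eV := Fh_Vh _ _ eF.
have loadE : flow_load u' e = flow_load u e.
  rewrite /flow_load (bending_eq0L u' u e u'V uV eV u'u); congr (_ + _ * _).
  by apply: lumped_eq => j jJ; rewrite (u'u _ (node_in j jJ)).
have ee0 : flow_form e e = 0.
  rewrite {1}/e (flow_form_linear _ _ _ _ d'V dV eV).
  rewrite ((flow_equationE u d e uV dV eV).1 (eqd e eF)).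
  by rewrite ((flow_equationE u' d' e u'V d'V eV).1 (eqd' e eF')) loadE mulN1r addNr.
have e0 : eq0L e 0.
  by apply: contrapT => e0; have := flow_form_gt0 e eV e0; rewrite ee0 ltxx.
move=> x xin; have := e0 x xin; rewrite /e !fctE scaleN1r => /eqP.
by rewrite addrC subr_eq0 => /eqP.
Qed.

(** * The iteration *)

Lemma sheet_flow_exists u0 : Vh J z u0 -> exists u d : nat -> R -> 'rV[R]_3,
  forall K, sheet_flow J z delta eps tau star u0 K u d.
Proof.
move=> u0V.
have /choice[step stepP] w : exists d, Vh J z w -> Fh J z w d /\
    forall v, Fh J z w v -> flow_equation J z delta eps star w (w + tau *: d) d v.
  have [wV|nV] := pselect (Vh J z w); last by exists 0.
  by have [d dP] := flow_step_exists w wV; exists d.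
pose u := fix u k := if k is k'.+1 then u k' + tau *: step (u k') else u0.
have uV k : Vh J z (u k).
  elim: k => [//|k IH] /=; rewrite addrC; apply: Vh_linear => //.
  exact: Fh_Vh (stepP _ IH).1.
exists u, (fun k => step (u k.-1)) => K; split=> // -[//|k] _.
have [dF dP] := stepP _ (uV k); split; [exact: dF|by []|exact: dP].
Qed.

Lemma sheet_flow_Vh u0 K u d : Vh J z u0 ->
  sheet_flow J z delta eps tau star u0 K u d ->
  forall k, (k <= K)%N -> Vh J z (u k).
Proof.
move=> u0V [u0E step]; elim=> [|k IH] kK; first by rewrite u0E.
have [dF -> _] := step k.+1 kK; rewrite addrC; apply: Vh_linear.
  exact: Fh_Vh dF.
exact: IH (ltnW kK).
Qed.

Lemma sheet_flow_unique u0 K u d u' d' : Vh J z u0 ->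
  sheet_flow J z delta eps tau star u0 K u d ->
  sheet_flow J z delta eps tau star u0 K u' d' ->
  (forall k, (k <= K)%N -> eq0L (u k) (u' k)) /\
  (forall k, (1 <= k <= K)%N -> eq0L (d k) (d' k)).
Proof.
move=> u0V fl fl'; have uV := sheet_flow_Vh _ _ _ _ u0V fl.
have u'V := sheet_flow_Vh _ _ _ _ u0V fl'.
case: fl => u0E step; case: fl' => u'0E step'.
have next k : (k < K)%N -> eq0L (u k) (u' k) -> eq0L (d k.+1) (d' k.+1).
  move=> kK uu'; have [dF uE dP] := step k.+1 kK.
  have [d'F u'E d'P] := step' k.+1 kK.
  rewrite uE in dP; rewrite u'E in d'P.
  exact: flow_step_unique (uV k (ltnW kK)) (u'V k (ltnW kK)) uu' dF d'F dP d'P.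
have uu' k : (k <= K)%N -> eq0L (u k) (u' k).
  elim: k => [|k IH] kK x xin; first by rewrite u0E u'0E.
  have [_ -> _] := step k.+1 kK; have [_ -> _] := step' k.+1 kK.
  have uu'k := IH (ltnW kK).
  by rewrite !fctE /= (uu'k x xin) (next k kK uu'k x xin).
split=> // -[//|k] kK; exact: next kK (uu' k (ltnW kK)).
Qed.

(** * Energy decay *)

Lemma energyE u : energy J z delta eps u =
  2^-1 * bending u u +
  (2 * eps)^-1 * lumped (fun y => neg_part (third (u y) - delta) ^+ 2).
Proof.
rewrite /energy -bendingE; congr (_ * _ + _).
by apply: eq_Rintegral => x _; exact: enorm_sqr.
Qed.

Lemma energy_ge0 u : 0 <= energy J z delta eps u.
Proof.
rewrite energyE addr_ge0 // mulr_ge0 ?bending_ge0 ?invr_ge0 //.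
  by rewrite mulr_ge0 // ltW.
by apply: lumped_ge0 => j _; exact: sqr_ge0.
Qed.

(** With $g(s)=\frac12s_-^2=\frac12s^2-\frac12s_+^2$, convexity of the first
square gives $\frac12a^2-\frac12b^2\le a(a-b)$ and convexity of the second one
gives $\frac12a_+^2-\frac12b_+^2\ge b_+(a-b)$; the difference of the two bounds
$g(a)-g(b)$. *)
Lemma obstacle_splitting (a b : R) :
  2 * pos_part b * (a - b) + neg_part a ^+ 2 <= 2 * a * (a - b) + neg_part b ^+ 2.
Proof.
rewrite /pos_part /neg_part.
have sq := sqr_ge0 (a - b).
have [ha|ha] := leP a 0; have [hb|hb] := leP b 0.
- by lra.
- by have := mulr_ge0_le0 (ltW hb) ha; nra.
- by nra.
- by lra.
Qed.

(** The real-number core of the energy step. [bdd], [bud] and [buu] stand for the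
bending form at the pairs formed from the old iterate $u$ and the update $d$,
so that the two sums with $\tau$ are its values at $(u+\tau d,d)$ and
$(u+\tau d,u+\tau d)$; [lw], [lu], [ew], [eu] stand for the implicit and
explicit obstacle terms and the penalties of the new and the old iterate, and
[s] for $\|d\|_*^2$.  The bending part leaves the
slack $\frac12\tau^2\|d''\|^2$. *)
Lemma energy_balance (s bdd bud buu lw lu ew eu : R) : 0 <= bdd ->
  (2 * tau) * lu + ew <= (2 * tau) * lw + eu ->
  s + (tau * bdd + bud) + eps^-1 * lw = eps^-1 * lu ->
  2^-1 * (tau * (tau * bdd + bud) + (tau * bud + buu)) + (2 * eps)^-1 * ew
    + tau * s <= 2^-1 * buu + (2 * eps)^-1 * eu.
Proof.
move=> bdd0 h E; rewrite invfM.
have e0 : 0 < eps^-1 by rewrite invr_gt0.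
have := ler_wpM2l (ltW e0) h.
have -> : s = eps^-1 * lu - eps^-1 * lw - (tau * bdd + bud) by lra.
have t2 : 0 <= tau ^+ 2 * bdd by rewrite mulr_ge0 // sqr_ge0.
by move: t2 {E h e0}; set ie := eps^-1; lra.
Qed.

Lemma energy_step u d : Vh J z u -> Fh J z u d ->
  flow_equation J z delta eps star u (u + tau *: d) d d ->
  energy J z delta eps (u + tau *: d) + tau * star_norm star d ^+ 2
    <= energy J z delta eps u.
Proof.
move=> uV dF; have dV := Fh_Vh _ _ dF; pose w := tau *: d + u.
have wV : Vh J z w by exact: Vh_linear.
rewrite (addrC u) -/w (star_norm_sqr d dV) !energyE.
rewrite /flow_equation bendingE /innerh -!/(lumped _).
set Lw := lumped (fun x => (third (w x) - delta) * _).
set Lu := lumped (fun x => pos_part _ * _).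
set Ew := lumped (fun y => neg_part (third (w y) - delta) ^+ 2).
set Eu := lumped (fun y => neg_part (third (u y) - delta) ^+ 2).
have obst : (2 * tau) * Lu + Ew <= (2 * tau) * Lw + Eu.
  rewrite -!lumped_linear; apply: lumped_le => j _.
  have := obstacle_splitting (third (w (z j)) - delta) (third (u (z j)) - delta).
  have -> : third (w (z j)) - delta - (third (u (z j)) - delta) =
      tau * third (d (z j)) by rewrite /w /third !fctE !mxE; ring.
  by rewrite !mulrA -!(mulrA 2 _ tau) !(mulrC _ tau) !mulrA !(mulrC tau 2).
have bwd : bending w d = tau * bending d d + bending u d.
  exact: bending_linear.
have bww : bending w w = tau * bending w d + bending w u.
  by rewrite -(bendingC d w) -(bendingC u w); exact: bending_linear.
have bwu : bending w u = tau * bending u d + bending u u.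
  by rewrite -(bendingC d u); exact: bending_linear.
by rewrite bww bwu bwd; exact: energy_balance (bending_ge0 d) obst.
Qed.

Lemma sheet_flow_energy u0 K u d : Vh J z u0 ->
  sheet_flow J z delta eps tau star u0 K u d ->
  forall k, (k <= K)%N ->
  energy J z delta eps (u k)
    + tau * (\sum_(1 <= i < k.+1) star_norm star (d i) ^+ 2)
  <= energy J z delta eps u0.
Proof.
move=> u0V fl; have uV := sheet_flow_Vh _ _ _ _ u0V fl; case: fl => u0E step.
elim=> [_|k IH kK]; first by rewrite big_geq // mulr0 addr0 u0E.
apply: le_trans (IH (ltnW kK)); have [dF uE dP] := step k.+1 kK.
rewrite big_nat_recr //= mulrDr addrCA addrC lerD2r uE.
apply: energy_step => //; first exact: uV _ (ltnW kK).
by have := dP _ dF; rewrite uE.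
Qed.
(** * Violation of the constraints *)

Lemma dot_orthogonal_update c (s t : 'rV[R]_3) : dot s t = 0 ->
  dot (s + c *: t) (s + c *: t) = dot s s + c ^+ 2 * dot t t.
Proof.
move=> st; rewrite (addrC s) dot_linear !dot_linear_r (dotC t s) st.
by rewrite mulr0 !add0r addr0 expr2; ring.
Qed.

(** An orthogonal update adds exactly its squared length, so the violations
accumulate without any further error terms. *)
Lemma sheet_flow_nodal u0 K u d : Ah J z u0 ->
  sheet_flow J z delta eps tau star u0 K u d ->
  forall k j, (k <= K)%N -> (j <= J)%N ->
  enorm (derive1 (u k) (z j)) ^+ 2 - 1 =
    tau ^+ 2 * (\sum_(1 <= i < k.+1) dot (derive1 (d i) (z j)) (derive1 (d i) (z j)))
  /\ PhiS (u k (z j)) = tau ^+ 2 * (\sum_(1 <= i < k.+1) dot (d i (z j)) (d i (z j))).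
Proof.
move=> [u0V u0z _] fl; have uV := sheet_flow_Vh _ _ _ _ u0V fl.
case: fl => u0E step; rewrite /PhiS.
elim=> [|k IH] j kK jJ.
  have [n1 n2] := u0z j jJ; rewrite u0E !big_geq // mulr0 n1 expr1n subrr.
  by split=> //; move: n2; rewrite /PhiS.
have [IH1 IH2] := IH j (ltnW kK) jJ.
have [dF -> _] := step k.+1 kK; have [dV dz _] := dF; have [z1 z2] := dz j jJ.
have ud : dot (u k (z j)) (d k.+1 (z j)) = 0.
  by move/eqP: z1; rewrite dot_grad_PhiS mulf_eq0 pnatr_eq0 /= => /eqP.
have sumS (F : nat -> R) :
    \sum_(1 <= i < k.+2) F i = \sum_(1 <= i < k.+1) F i + F k.+1.
  by rewrite big_nat_recr.
have derE : derive1 (u k + tau *: d k.+1) (z j) =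
    derive1 (u k) (z j) + tau *: derive1 (d k.+1) (z j).
  rewrite (addrC (u k)) (derive1_linear _ _ _ dV.1 (uV k (ltnW kK)).1).
  by rewrite [LHS]addrC.
have valE : (u k + tau *: d k.+1) (z j) = u k (z j) + tau *: d k.+1 (z j) by [].
split; rewrite sumS mulrDr.
  by rewrite -IH1 derE !enorm_sqr (dot_orthogonal_update _ _ _ z2) addrAC.
by rewrite -IH2 !enorm_sqr valE (dot_orthogonal_update _ _ _ ud) addrAC.
Qed.

Lemma Lhinf_le (f : R -> R) B : 0 <= B ->
  (forall j, (j <= J)%N -> `|f (z j)| <= B) -> Lhinf J z f <= B.
Proof.
by move=> B0 fB; apply: bigmax_le => // j _; apply: fB; rewrite -ltnS ltn_ord.
Qed.

Lemma nodal_le_Lhinf (f : R -> R) j : (j <= J)%N -> `|f (z j)| <= Lhinf J z f.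
Proof.
move=> jJ; exact: (le_bigmax _ (fun j : 'I_J.+1 => `|f (z j)|) (@Ordinal J.+1 j jJ)).
Qed.

(** One factor $\tau$ is absorbed by the dissipation in the energy estimate. *)
Lemma sheet_flow_increments u0 K u d (C : R) (q : (R -> 'rV[R]_3) -> R) : Vh J z u0 ->
  sheet_flow J z delta eps tau star u0 K u d -> 0 <= C ->
  (forall v, Vh J z v -> q v <= C * star_norm star v ^+ 2) ->
  forall k, (k <= K)%N ->
  tau ^+ 2 * (\sum_(1 <= i < k.+1) q (d i)) <= C * tau * energy J z delta eps u0.
Proof.
move=> u0V fl C0 qC k kK.
have en := sheet_flow_energy _ _ _ _ u0V fl k kK.
have [_ step] := fl; set S := \sum_(1 <= i < k.+1) star_norm star (d i) ^+ 2.
have qS : \sum_(1 <= i < k.+1) q (d i) <= C * S.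
  rewrite mulr_sumr; apply: ler_sum_nat => i /andP[i1 ik]; apply: qC.
  have iK : (1 <= i <= K)%N by rewrite i1 (leq_trans _ kK).
  by have [dF _ _] := step i iK; exact: Fh_Vh dF.
have tS : tau * S <= energy J z delta eps u0.
  by apply: le_trans en; rewrite lerDr energy_ge0.
rewrite expr2 -mulrA (mulrC C) -[leRHS]mulrA; apply: ler_wpM2l; first exact: ltW.
apply: (@le_trans _ _ (C * (tau * S))); last exact: ler_wpM2l.
by rewrite mulrCA; apply: ler_wpM2l => //; exact: ltW.
Qed.

(** The initial curve has unit speed at the nodes, so the estimate applied to it
reads $1\le c_*\|u_h^0\|_*^2$. *)
Lemma inverse_estimate_constant_gt0 u0 cstar : Ah J z u0 ->
  (forall v, Vh J z v ->
    Lhinf J z (fun x => enorm (derive1 v x)) ^+ 2 <= cstar * star_norm star v ^+ 2) ->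
  0 < cstar.
Proof.
move=> [u0V u0z _] hc; rewrite ltNge; apply/negP => c0.
have := nodal_le_Lhinf (fun x => enorm (derive1 u0 x)) 0%N (leq0n J).
rewrite (u0z 0%N (leq0n J)).1 normr1 => L1.
have : 1 <= cstar * star_norm star u0 ^+ 2.
  by apply: le_trans (hc u0 u0V); rewrite exprn_ege1.
by apply/negP; rewrite -ltNge (le_lt_trans _ ltr01) // mulr_le0_ge0 ?sqr_ge0.
Qed.

(** [f] is a violated constraint and [q j] the squared length of an update at the
node [z j], so that both constraints are instances. *)
Lemma sheet_flow_sup_bound u0 K u d (C : R) (f : (R -> 'rV[R]_3) -> R -> R)
    (q : nat -> (R -> 'rV[R]_3) -> R) : Vh J z u0 ->
  sheet_flow J z delta eps tau star u0 K u d -> 0 <= C ->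
  (forall v j, (j <= J)%N -> 0 <= q j v) ->
  (forall v j, Vh J z v -> (j <= J)%N -> q j v <= C * star_norm star v ^+ 2) ->
  (forall k j, (k <= K)%N -> (j <= J)%N ->
    f (u k) (z j) = tau ^+ 2 * (\sum_(1 <= i < k.+1) q j (d i))) ->
  \big[Num.max/0]_(k < K.+1) Lhinf J z (f (u k)) <= C * tau * energy J z delta eps u0.
Proof.
move=> u0V fl C0 q0 qC fE.
have B0 : 0 <= C * tau * energy J z delta eps u0.
  by rewrite mulr_ge0 ?energy_ge0 // mulr_ge0 // ltW.
apply: bigmax_le => // k _; apply: Lhinf_le => // j jJ.
have kK : (k <= K)%N by rewrite -ltnS ltn_ord.
rewrite fE // ger0_norm; last first.
  by rewrite mulr_ge0 ?sqr_ge0 //; apply: sumr_ge0 => i _; exact: q0.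
apply: (sheet_flow_increments _ _ _ _ C (q j) u0V fl C0) => // v vV.
exact: qC.
Qed.

End mesh.

Theorem proposition3p6 (R : realType) (J : nat) (z : nat -> R)
  (hz : is_partition J z)
  (delta eps : R) (hdelta : 0 <= delta) (heps : 0 < eps)
  (star : (R -> 'rV[R]_3) -> (R -> 'rV[R]_3) -> R)
  (hstar : is_inner_product (Vh J z) star)
  (u0 : R -> 'rV[R]_3) (hu0 : Ah J z u0)
  (hobst : forall j, (j <= J)%N -> delta <= third (u0 (z j))) :
  (* (i) *)
  (forall tau : R, 0 < tau ->
    [/\ exists u d : nat -> R -> 'rV[R]_3,
          forall K, sheet_flow J z delta eps tau star u0 K u d,
        forall (K : nat) (u d u' d' : nat -> R -> 'rV[R]_3),
          sheet_flow J z delta eps tau star u0 K u d ->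
          sheet_flow J z delta eps tau star u0 K u' d' ->
          (forall k, (k <= K)%N -> eq0L (u k) (u' k)) /\
          (forall k, (1 <= k <= K)%N -> eq0L (d k) (d' k))
      & forall (K : nat) (u d : nat -> R -> 'rV[R]_3),
          sheet_flow J z delta eps tau star u0 K u d ->
          (forall k, (k <= K)%N -> Vh J z (u k)) /\
          energy J z delta eps (u K)
            + tau * (\sum_(1 <= k < K.+1) star_norm star (d k) ^+ 2)
          <= energy J z delta eps u0])
  /\
  (* (ii) *)
  (forall cstar : R,
    (forall v, Vh J z v ->
      Lhinf J z (fun x => enorm (derive1 v x)) ^+ 2 <= cstar * star_norm star v ^+ 2) ->
   forall cS2 r : R, 0 < cS2 -> 0 <= r ->
    (forall s : 'rV[R]_3, enorm (hess PhiS s) <= cS2 * (1 + enorm s `^ r)) ->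
   exists c' : R, 0 < c' /\
    forall tau : R, 0 < tau ->
    forall (K : nat) (u d : nat -> R -> 'rV[R]_3),
      sheet_flow J z delta eps tau star u0 K u d ->
      \big[Num.max/0]_(k < K.+1)
        Lhinf J z (fun x => enorm (derive1 (u k) x) ^+ 2 - 1)
        <= cstar * tau * energy J z delta eps u0
      /\
      \big[Num.max/0]_(k < K.+1) Lhinf J z (fun x => PhiS (u k x))
        <= cstar * cS2 * c' * tau * (energy J z delta eps u0) `^ (r + 1)).
Proof.
have u0V : Vh J z u0 by case: hu0.
split.
  move=> tau tau0; split.
  - exact: (sheet_flow_exists R J z hz star hstar delta eps tau heps tau0 u0 u0V).
  - move=> K u d u' d'.
    exact: (sheet_flow_unique R J z hz star hstar delta eps tau heps tau0 u0).
  - move=> K u d fl; split.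
      exact: (sheet_flow_Vh R J z star delta eps tau u0 K u d u0V fl).
    exact: (sheet_flow_energy R J z hz star hstar delta eps tau heps u0 K u d u0V fl
      K (leqnn K)).
move=> cstar hc cS2 r cS20 r0 _.
have cstar0 := inverse_estimate_constant_gt0 R J z star u0 cstar hu0 hc.
have [C C0 nodC] := nodal_bound R J z hz star hstar.
set e0 := energy J z delta eps u0.
have e0_ge0 : 0 <= e0 by exact: (energy_ge0 R J z hz delta eps heps).
have [c' [c'0 c'P]] : exists c', 0 < c' /\ C * e0 <= cstar * cS2 * c' * e0 `^ (r + 1).
  move: e0_ge0; rewrite le_eqVlt => /predU1P[<-|e0_gt0].
    exists 1; split=> //; rewrite mulr0 mulr_ge0 ?powR_ge0 //.
    by rewrite mulr1 mulr_ge0 // ltW.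
  (* Chosen such that both sides agree, by $e_0^{r+1}=e_0^re_0$. *)
  exists (C / (cstar * cS2 * e0 `^ r)).
  have er0 : 0 < e0 `^ r by exact: powR_gt0.
  split; first by rewrite divr_gt0 // !mulr_gt0.
  rewrite powRD; last by rewrite (gt_eqF e0_gt0) implybT.
  rewrite (powRr1 (ltW e0_gt0)) le_eqVlt; apply/orP; left; apply/eqP.
  by field; rewrite !gt_eqF.
exists c'; split=> // tau tau0 K u d fl.
have nod := sheet_flow_nodal R J z star delta eps tau u0 K u d hu0 fl.
split.
  apply: (sheet_flow_sup_bound R J z hz star hstar delta eps tau heps tau0 u0 K u d cstar
    (fun v x => enorm (derive1 v x) ^+ 2 - 1)
    (fun j v => dot (derive1 v (z j)) (derive1 v (z j))) u0V fl (ltW cstar0)).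
  - by move=> v j _; exact: dot_ge0.
  - move=> v j vV jJ; apply: le_trans (hc v vV); rewrite -enorm_sqr.
    have := nodal_le_Lhinf R J z (fun x => enorm (derive1 v x)) j jJ.
    rewrite ger0_norm ?sqrtr_ge0 // => h.
    by rewrite lerXn2r ?nnegrE ?sqrtr_ge0 // (le_trans _ h) // sqrtr_ge0.
  - by move=> k j kK jJ; exact: (nod k j kK jJ).1.
apply: (@le_trans _ _ (C * tau * e0)); last first.
  by rewrite mulrAC [leRHS]mulrAC; apply: ler_wpM2r c'P; exact: ltW.
apply: (sheet_flow_sup_bound R J z hz star hstar delta eps tau heps tau0 u0 K u d C
  (fun v x => PhiS (v x)) (fun j v => dot (v (z j)) (v (z j))) u0V fl (ltW C0)).
- by move=> v j _; exact: dot_ge0.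
- move=> v j vV jJ; rewrite (star_norm_sqr R J z star hstar v vV).
  exact: nodC.
- by move=> k j kK jJ; exact: (nod k j kK jJ).2.
Qed.
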